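(* Let $m\in\mathbb{N}_+$ and let $\mu_1,\ldots,\mu_m\in\mathbb{C}$. The formal inverse (for composition) of $a(X)=X(1-\mu_1X)\cdots(1-\mu_mX)$ is $$a^{-1}(X)=X\Big(1+\sum_{n\ge 1}\frac{1}{n+1}u_nX^n\Big),$$ where for all $n\ge 1$ $$u_n=\frac{1}{(n!)^m}\sum_{j_1+\cdots+j_m=n}\frac{(n+j_1)!\cdots(n+j_m)!}{j_1!\cdots j_m!}\,\mu_1^{j_1}\cdots\mu_m^{j_m}.$$ Moreover, if $m\ge 2$ and $\mu_1\ne 0$, then, with $y_k=\mu_k/\mu_1$ for all $k\in\{2,\ldots,m\}$, $$u_n=\frac{\mu_1^n}{(n!)^m}\sum_{j_2+\cdots+j_m\le n}\frac{(2n-j_2-\cdots-j_m)!\,(n+j_2)!\cdots(n+j_m)!}{(n-j_2-\cdots-j_m)!\,j_2!\cdots j_m!}\,y_2^{j_2}\cdots y_m^{j_m}.$$ In particular, when $m=2$ and $\mu_1\ne 0$, with $y=\mu_2/\mu_1$, $$u_n=\frac{\mu_1^n}{(n!)^2}\sum_{0\le k\le n}\frac{(2n-k)!\,(n+k)!}{(n-k)!\,k!}\,y^k.$$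
   Context: $\mathbb{N}_+$ is the set of positive integers. All summation indices $j_1,\ldots,j_m,k$ range over nonnegative integers. The formal inverse of a power series $a(X)\in\mathbb{C}[[X]]$ with $a(X)\equiv X$ mod $X^2$ is the unique power series $a^{-1}(X)\in X\mathbb{C}[[X]]$ with $a(a^{-1}(X))=a^{-1}(a(X))=X$. *)

(* Defs.v *)
(* The complex numbers are R[i] for R : realType. *)
From mathcomp Require Import all_boot all_order all_algebra.
From mathcomp Require Import reals complex.

Set Implicit Arguments.
Unset Strict Implicit.
Unset Printing Implicit Defensive.

Import Order.TTheory GRing.Theory Num.Theory.
Local Open Scope ring_scope.

(* A formal power series over K is its coefficient sequence nat -> K. The
   pointwise ring operations that a function space may carry are not those of
   K[[X]]: the product is fps_mul. *)
Definition fps (K : Type) : Type := nat -> K.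

Section FormalPowerSeries.
Variable K : comNzRingType.
Implicit Types f g a b : fps K.

Definition fps_of_poly (p : {poly K}) : fps K := fun n => p`_n.

Definition fps_mul f g : fps K := fun n => \sum_(i < n.+1) f i * g (n - i)%N.

Definition fps_exp f (k : nat) : fps K := iter k (fps_mul f) (fps_of_poly 1).

(* The composite f(g(X)), meaningful when g 0 = 0: then g^k is divisible by
   X^k, so the terms with k > n do not contribute to the coefficient of X^n. *)
Definition fps_comp f g : fps K :=
  fun n => \sum_(k < n.+1) f k * fps_exp g k n.

Definition is_formal_inverse a b : Prop :=
  [/\ a 0%N = 0, a 1%N = 1 &
      unique (fun c : fps K => [/\ c 0%N = 0,
                                   fps_comp a c = fps_of_poly 'X &
                                   fps_comp c a = fps_of_poly 'X]) b].

End FormalPowerSeries.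

(* In a sum over (j_1, ..., j_m) subject to j_1 + ... + j_m = n (or <= n), each
   j_i is at most n, whence the index type {ffun 'I_m -> 'I_n.+1}. *)
Definition u_coef (K : fieldType) (m : nat) (mu : 'I_m -> K) (n : nat) : K :=
  ((n`! ^ m)%N%:R)^-1 *
  \sum_(j : {ffun 'I_m -> 'I_n.+1} | (\sum_(i < m) j i == n)%N)
     (\prod_(i < m) (n + j i)`!)%N%:R / (\prod_(i < m) (j i)`!)%N%:R
     * \prod_(i < m) mu i ^+ j i.

(* Main.v *)
Require Import Defs.
From mathcomp Require Import all_boot all_order all_algebra.
From mathcomp Require Import reals complex.
From mathcomp Require Import boolp.

Set Implicit Arguments.
Unset Strict Implicit.
Unset Printing Implicit Defensive.

Import Order.TTheory GRing.Theory Num.Theory.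
Local Open Scope ring_scope.
Local Open Scope complex_scope.

(* Lagrange inversion, in triangular-matrix form. Put a = X psi and let H_l be
   an inverse of psi^(l+1) modulo X^(l+1). The matrices
     A = ([X^(k+1)] a^(i+1))_(i, k)  and
     B = ((k+1)/(l+1) [X^(l-k)] H_l)_(k, l)
   satisfy A B = 1: by the product rule the (i, l) entry of A B is
   (i+1)/(l+1) [X^(l-i)] (psi^i H_l) a', and [X^j] psi^-(j+1) a' is 1 for j = 0
   and 0 for j > 0, because j times it is the coefficient of X^j in
   j psi^-j - X (psi^-j)'. Hence B A = 1, whose first row says that the series
   b = sum_n [X^n] H_n / (n+1) X^(n+1) satisfies b o a = X. Composition on the
   right with a is injective and (a o b) o a = a, so a o b = X as well and b is
   unique. For psi = prod_i (1 - mu_i X) the negative binomial series provides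
   H_n and turns [X^n] H_n into u_n. *)

(** * Congruence modulo X^N and composition of power series *)

Section CongruenceModXn.
Variable K : comNzRingType.
Implicit Types (p q r : {poly K}) (f g h : fps K).

Definition eq_mod_Xn N p q := forall i, (i < N)%N -> p`_i = q`_i.

Lemma eq_mod_Xn_le M N p q :
  (M <= N)%N -> eq_mod_Xn N p q -> eq_mod_Xn M p q.
Proof. by move=> leMN pq i iM; apply: pq; apply: leq_trans leMN. Qed.

Lemma eq_mod_XnM N p q p' q' :
  eq_mod_Xn N p p' -> eq_mod_Xn N q q' -> eq_mod_Xn N (p * q) (p' * q').
Proof.
move=> pp' qq' i iN; rewrite !coefM; apply: eq_bigr => j _.
have ji : (j <= i)%N by rewrite -ltnS.
by rewrite pp' ?qq' ?(leq_ltn_trans _ iN) // leq_subr.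
Qed.

Lemma eq_mod_XnX N p q k :
  eq_mod_Xn N p q -> eq_mod_Xn N (p ^+ k) (q ^+ k).
Proof.
move=> pq; elim: k => [|k IHk]; first by rewrite !expr0.
by rewrite !exprS; apply: eq_mod_XnM.
Qed.

Lemma eq_mod_Xn_deriv N p q :
  eq_mod_Xn N.+1 p q -> eq_mod_Xn N p^`() q^`().
Proof. by move=> pq i iN; rewrite !coef_deriv pq. Qed.

Lemma eq_mod_Xn_prod1 N (I : finType) (P : I -> {poly K}) :
  (forall i, eq_mod_Xn N (P i) 1) -> eq_mod_Xn N (\prod_i P i) 1.
Proof.
move=> P1; apply: (big_ind (fun p => eq_mod_Xn N p 1)) => // p q p1 q1.
by rewrite -[1]mulr1; apply: eq_mod_XnM.
Qed.

Lemma coef_exp_ltn q k n : q`_0 = 0 -> (n < k)%N -> (q ^+ k)`_n = 0.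
Proof.
move=> q0; elim: k n => // k IHk n nk.
rewrite exprS coefM big1 // => -[[|j] /= jn] _; first by rewrite q0 mul0r.
rewrite IHk ?mulr0 //; case: n jn nk => // n jn nk.
by rewrite subSS (leq_ltn_trans (leq_subr _ _)).
Qed.

Lemma coef_comp_poly0 p q n : q`_0 = 0 ->
  (p \Po q)`_n = \sum_(k < n.+1) p`_k * (q ^+ k)`_n.
Proof.
move=> q0; rewrite coef_comp_poly.
rewrite -!(big_mkord xpredT (fun k => p`_k * (q ^+ k)`_n)).
(* The two ranges differ only by zero terms: q^k has no X^n term for k > n, and [p] has no
   coefficient from its size on. *)
have [le_np|/ltnW le_pn] := leqP n.+1 (size p).
  rewrite (big_cat_nat (n := n.+1) _ le_np) //=.
  rewrite [X in _ + X]big_nat_cond [X in _ + X]big1 ?addr0 //.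
  by move=> k; rewrite andbT => /andP[nk _]; rewrite coef_exp_ltn ?mulr0.
rewrite [RHS](big_cat_nat (n := size p)) //=.
rewrite [X in _ + X]big_nat_cond [X in _ + X]big1 ?addr0 //.
by move=> k; rewrite andbT => /andP[pk _]; rewrite nth_default ?mul0r.
Qed.

Lemma fps_exp_coef N g q k :
  (forall i, (i < N)%N -> g i = q`_i) ->
  forall n, (n < N)%N -> fps_exp g k n = (q ^+ k)`_n.
Proof.
move=> gq; elim: k => [|k IHk] n nN //.
rewrite [LHS]/(fps_mul g (fps_exp g k) n) exprS coefM; apply: eq_bigr => j _.
have jn : (j <= n)%N by rewrite -ltnS.
by rewrite gq ?IHk ?(leq_ltn_trans _ nN) // leq_subr.
Qed.

(** Transfers identities between polynomial composites to power series, by truncation. *)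
Lemma fps_comp_coef N f g p q : q`_0 = 0 ->
  (forall i, (i < N)%N -> f i = p`_i) ->
  (forall i, (i < N)%N -> g i = q`_i) ->
  forall n, (n < N)%N -> fps_comp f g n = (p \Po q)`_n.
Proof.
move=> q0 fp gq n nN; rewrite coef_comp_poly0 //; apply: eq_bigr => k _.
by rewrite (fps_exp_coef _ gq) // fp // (leq_trans _ nN).
Qed.

Lemma fps_compA f g h : g 0%N = 0 -> h 0%N = 0 ->
  fps_comp (fps_comp f g) h = fps_comp f (fps_comp g h).
Proof.
move=> g0 h0; apply/funext => n.
pose T (f : fps K) := \poly_(i < n.+1) f i.
have TE s i : (i < n.+1)%N -> s i = (T s)`_i by move=> lin; rewrite coef_poly lin.
have Tg0 : (T g)`_0 = 0 by rewrite -TE.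
have Th0 : (T h)`_0 = 0 by rewrite -TE.
have Tgh0 : (T g \Po T h)`_0 = 0.
  by rewrite coef_comp_poly0 // big_ord1 Tg0 mul0r.
rewrite (@fps_comp_coef n.+1 _ h (T f \Po T g) (T h)) //; last 2 first.
- by apply: fps_comp_coef => //; apply: TE.
- exact: TE.
rewrite (@fps_comp_coef n.+1 f _ (T f) (T g \Po T h)) ?comp_polyA //.
  exact: TE.
by apply: fps_comp_coef => //; apply: TE.
Qed.

Lemma fps_comp_polyX f : fps_comp f (fps_of_poly 'X) = f.
Proof.
apply/funext => n; rewrite (@fps_comp_coef n.+1 f _ (\poly_(i < n.+1) f i) 'X) //.
- by rewrite comp_polyXr coef_poly ltnSn.
- by rewrite coefX.
- by move=> i lin; rewrite coef_poly lin.
Qed.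

Lemma fps_polyX_comp f : f 0%N = 0 -> fps_comp (fps_of_poly 'X) f = f.
Proof.
move=> f0; apply/funext => n.
rewrite (@fps_comp_coef n.+1 _ f 'X (\poly_(i < n.+1) f i)) //.
- by rewrite comp_polyX coef_poly ltnSn.
- by rewrite coef_poly.
- by move=> i lin; rewrite coef_poly lin.
Qed.

Lemma fps_mulX f n :
  fps_mul (fps_of_poly 'X) f n = if n is k.+1 then f k else 0.
Proof.
rewrite /fps_mul /fps_of_poly big_ord_recl coefX mul0r add0r.
case: n => [|n]; first by rewrite big_ord0.
rewrite big_ord_recl coefX mul1r big1 ?addr0 ?subSS ?subn0 // => i _.
by rewrite coefX mul0r.
Qed.

Lemma coef_mulX_exp (psi : {poly K}) k n :
  (('X * psi) ^+ k)`_n = if (n < k)%N then 0 else (psi ^+ k)`_(n - k).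
Proof. by rewrite exprMn coefXnM. Qed.

(** Composition with X psi is unitriangular: its coefficient of X^n is [f n] plus a combination of
    the [f k] with k < n, so strong induction applies. *)
Lemma fps_comp_inj (psi : {poly K}) f g : psi`_0 = 1 ->
  fps_comp f (fps_of_poly ('X * psi)) = fps_comp g (fps_of_poly ('X * psi)) ->
  f = g.
Proof.
move=> psi0 fg; apply/funext; elim/ltn_ind => n IHn.
have := congr1 (fun s => s n) fg; rewrite /fps_comp !big_ord_recr /=.
rewrite (@fps_exp_coef n.+1 _ ('X * psi) n) // coef_mulX_exp ltnn subnn.
rewrite -horner_coef0 horner_exp horner_coef0 psi0 expr1n !mulr1.
by under eq_bigr => i _ do rewrite IHn //; move/addrI.
Qed.

(** By Pascal's rule, multiplying by 1 - cX turns the truncated series for exponent l + 1 into the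
    one for l. *)
Lemma negative_binomial_poly N c l :
  eq_mod_Xn N ((1 - c *: 'X) ^+ l *
               \poly_(j < N) ('C((l + j).-1, j)%:R * c ^+ j)) 1.
Proof.
pose g l := \poly_(j < N) ('C((l + j).-1, j)%:R * c ^+ j).
have gS k : eq_mod_Xn N ((1 - c *: 'X) * g k.+1) (g k).
  move=> [|j] jN; rewrite mulrBl mul1r -scalerAl coefB coefZ coefXM /=.
    by rewrite mulr0 subr0 !coef_poly jN !bin0.
  rewrite !coef_poly jN (ltnW jN) addSn !addnS /= binS natrD mulrDl.
  by rewrite [c * _]mulrCA -exprS addrK.
elim: l => [|l IHl].
  (* For l = 0 the predecessor is truncated at j = 0, which gives 1; for j > 0 the binomial of j - 1
     over j vanishes. *)
  move=> j jN; rewrite expr0 mul1r coef_poly jN coef1 add0n.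
  by case: j jN => [|j] _; rewrite ?mulr1 //= bin_small ?mul0r.
move=> i iN; rewrite exprSr -mulrA -/(g l.+1) -IHl //.
by apply: eq_mod_XnM iN => //; apply: gS.
Qed.

End CongruenceModXn.

(** * Lagrange inversion *)

Section Lagrange.
Variable K : numFieldType.

(* [H] plays the role of psi^-(j+1), so [psi * H] that of psi^-j. *)
Lemma coef_inv_mul_deriv (psi H : {poly K}) N j : (j < N)%N ->
  eq_mod_Xn N (psi ^+ j.+1 * H) 1 ->
  (H * ('X * psi)^`())`_j = (j == 0%N)%:R.
Proof.
case: N => // N; rewrite ltnS => jN psiH.
rewrite derivM derivX mul1r mulrDr [H * psi]mulrC coefD mulrCA coefXM.
case: j jN psiH => [|j] jN psiH /=; first by rewrite addr0 -{1}[psi]expr1 psiH ?coef1.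
set G := psi * H in psiH *.
(* Differentiating psi^(j+1) G = 1 costs one order of precision, and psi^(j+1) factors out of the
   result. *)
have dG : eq_mod_Xn N (psi ^+ j.+1 * (H * psi^`() *+ j.+1 + G^`())) 0.
  have /eq_mod_Xn_deriv : eq_mod_Xn N.+1 (psi ^+ j.+1 * G) 1.
    by rewrite /G mulrA -exprSr.
  rewrite derivM -polyC1 derivC deriv_exp /= => dG i iN.
  rewrite -dG // mulrDr mulrnAr mulrnAl /G; congr ((_ *+ _ + _ : {poly K})`_i).
  by rewrite !mulrA -(mulrA psi^`()) -exprSr -[RHS]mulrA [RHS]mulrC.
(* The factor psi^(j+1) is cancelled by multiplying by its inverse [G]. *)
have dG0 : (H * psi^`() *+ j.+1 + G^`())`_j = 0.
  rewrite -[_ + _]mul1r.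
  have /(_ j jN) <- : eq_mod_Xn N (psi ^+ j.+2 * H * (H * psi^`() *+ j.+1 + G^`()))
                        (1 * (H * psi^`() *+ j.+1 + G^`())).
    by apply: eq_mod_XnM => //; apply: eq_mod_Xn_le psiH.
  rewrite exprS [psi * _ * H]mulrAC -(mulrA (psi * H)).
  by rewrite (@eq_mod_XnM _ N _ _ (psi * H) 0) // mulr0 coef0.
(* Both summands carry the factor j + 1, which is nonzero in characteristic 0. *)
move: dG0; rewrite coefD coefMn coef_deriv -mulrnDl addrC => /eqP.
by rewrite mulrn_eq0 => /eqP.
Qed.

Lemma lagrange_left (psi : {poly K}) (H : nat -> {poly K}) n :
  (forall l, eq_mod_Xn l.+1 (psi ^+ l.+1 * H l) 1) ->
  \sum_(k < n.+1) (H k)`_k / k.+1%:R * (('X * psi) ^+ k.+1)`_n.+1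
    = (n == 0%N)%:R.
Proof.
move=> psiH; set a := 'X * psi.
pose A := \matrix_(i < n.+1, k < n.+1) (a ^+ i.+1)`_k.+1.
pose B := \matrix_(k < n.+1, l < n.+1)
  (if (k <= l)%N then k.+1%:R / l.+1%:R * (H l)`_(l - k) else 0).
have AB : A *m B = 1%:M.
  apply/matrixP => i l; rewrite !mxE.
  have -> : \sum_j A i j * B j l = ((a ^+ i.+1)^`() * H l)`_l / l.+1%:R.
    rewrite coefM mulr_suml.
    pose F k := (a ^+ i.+1)^`()`_k * (H l)`_(l - k) / l.+1%:R.
    rewrite (big_ord_widen n.+1 F) // [RHS]big_mkcond.
    apply: eq_bigr => k _; rewrite !mxE ltnS; case: leqP => _; last by rewrite mulr0.
    rewrite /F coef_deriv -[(_`_ _) *+ _]mulr_natr -!mulrA; congr (_ * (_ * _)).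
    by rewrite mulrC.
  rewrite deriv_exp /= mulrnAl coefMn -val_eqE /=.
  have -> : a^`() * a ^+ i * H l = 'X^i * ((psi ^+ i * H l) * a^`()).
    by rewrite -mulrA mulrC /a exprMn !mulrA.
  rewrite coefXnM; have [li|il] := ltnP l i.
    by rewrite mul0rn mul0r gtn_eqF.
  (* Here psi^i H_l is an inverse of psi^(l-i+1), so the exponent is j = l - i. *)
  rewrite (@coef_inv_mul_deriv _ _ l.+1) ?ltnS ?leq_subr //; last first.
    by rewrite mulrA -exprD addSn subnK //; apply: psiH.
  rewrite subn_eq0 (eqn_leq i l) il /=; case: leqP => li; last by rewrite mul0rn mul0r.
  have -> : nat_of_ord l = i by apply/eqP; rewrite eqn_leq li il.
  by rewrite mulfV // pnatr_eq0.
(* The matrix size depends on [n], so the last column is the one for X^(n+1). *)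
have := congr1 (fun M => fun_of_matrix M ord0 ord_max) (mulmx1C AB).
rewrite !mxE -val_eqE /= eq_sym => <-; apply: eq_bigr => k _.
by rewrite !mxE /= subn0 mul1r [_^-1 * _]mulrC.
Qed.

Lemma lagrange_inversion (psi : {poly K}) (H : nat -> {poly K}) :
  psi`_0 = 1 ->
  (forall l, eq_mod_Xn l.+1 (psi ^+ l.+1 * H l) 1) ->
  is_formal_inverse (fps_of_poly ('X * psi))
    (fps_mul (fps_of_poly 'X) (fun n => (H n)`_n / n.+1%:R)).
Proof.
move=> psi0 psiH; set a := fps_of_poly _; set b := fps_mul _ _.
have a0 : a 0%N = 0 by rewrite /a /fps_of_poly coefXM.
have b0 : b 0%N = 0 by rewrite /b fps_mulX.
have ba : fps_comp b a = fps_of_poly 'X.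
  apply/funext => -[|n]; rewrite /fps_comp /fps_of_poly coefX.
    by rewrite big_ord1 b0 mul0r.
  rewrite big_ord_recl b0 mul0r add0r eqSS -(lagrange_left n psiH).
  by apply: eq_bigr => k _; rewrite /b fps_mulX (@fps_exp_coef _ n.+2 _ ('X * psi)).
split=> //; first by rewrite /a /fps_of_poly coefXM.
split; last by move=> c [_ _ ca]; apply: (fps_comp_inj psi0); rewrite -/a ba ca.
split=> //; apply: (fps_comp_inj psi0).
by rewrite -/a fps_compA // ba fps_comp_polyX fps_polyX_comp.
Qed.

End Lagrange.

(** * The numbers u_n as coefficients of a product *)

Lemma u_coefE (K : numFieldType) (m : nat) (mu : 'I_m -> K) (n : nat) :
  u_coef mu n =
  (\prod_(i < m) \poly_(j < n.+1) ('C(n + j, j)%:R * mu i ^+ j))`_n.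
Proof.
under eq_bigr => i _ do rewrite poly_def.
(* Each choice of indices contributes one monomial, of degree their sum; taking the coefficient of
   X^n restores the constraint. *)
rewrite bigA_distr_bigA coef_sum /u_coef mulr_sumr [LHS]big_mkcond.
apply: eq_bigr => J _; rewrite scaler_prod prodrXr coefZ coefXn eq_sym.
case: eqP => _; last by rewrite mulr0.
rewrite mulr1 big_split /= mulrA; congr (_ * _); rewrite -natr_prod.
(* The m factors n! that appear here cancel the leading inverse of (n!)^m. *)
have -> : (\prod_(i < m) (n + J i)`! =
           \prod_(i < m) 'C(n + J i, J i) * (\prod_(i < m) (J i)`! * n`! ^ m))%N.
  rewrite -[in (n`! ^ m)%N](card_ord m) -prod_nat_const -!big_split /=.
  by apply: eq_bigr => i _; rewrite -[in LHS](bin_fact (leq_addl n (J i))) addnK.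
have fact_neq0 : (n`! ^ m)%N%:R != 0 :> K.
  by rewrite pnatr_eq0 -lt0n expn_gt0 fact_gt0.
have prod_neq0 : (\prod_(i < m) (J i)`!)%N%:R != 0 :> K.
  by rewrite pnatr_eq0 -lt0n prodn_gt0 // => i; rewrite fact_gt0.
by rewrite !natrM mulrC !mulrA mulrAC mulfK // mulfK.
Qed.

(** * Elimination of the first index *)

Definition simplex_cons m n (j : {ffun 'I_m -> 'I_n.+1}) :
    {ffun 'I_m.+1 -> 'I_n.+1} :=
  [ffun i => if unlift ord0 i is Some k then j k
             else inord (n - \sum_(k < m) j k)].

(** Truncated subtraction never exceeds n, so [inord] is exact even if the tail sums to more than
    n. *)
Lemma simplex_cons0 m n (j : {ffun 'I_m -> 'I_n.+1}) :
  simplex_cons j ord0 = (n - \sum_(k < m) j k)%N :> nat.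
Proof. by rewrite ffunE unlift_none inordK // ltnS leq_subr. Qed.

Lemma simplex_cons_lift m n (j : {ffun 'I_m -> 'I_n.+1}) k :
  simplex_cons j (lift ord0 k) = j k.
Proof. by rewrite ffunE liftK. Qed.

Lemma big_simplex_cons (T : Type) (idx : T) (op : T -> T -> T) m n
    (F : 'I_m.+1 -> nat -> T) (j : {ffun 'I_m -> 'I_n.+1}) :
  \big[op/idx]_(i < m.+1) F i (simplex_cons j i) =
  op (F ord0 (n - \sum_(k < m) j k)%N)
     (\big[op/idx]_(k < m) F (lift ord0 k) (j k)).
Proof.
rewrite big_ord_recl simplex_cons0; congr (op _ _).
by apply: eq_bigr => k _; rewrite simplex_cons_lift.
Qed.

(** The constraint determines the head from the tail, so dropping the head inverts [simplex_cons]. A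
    tail with sum above n gets head 0 and misses the constraint. *)
Lemma sum_simplex_cons (V : nmodType) m n
    (F : {ffun 'I_m.+1 -> 'I_n.+1} -> V) :
  \sum_(J : {ffun 'I_m.+1 -> 'I_n.+1} | (\sum_(i < m.+1) J i == n)%N) F J =
  \sum_(j : {ffun 'I_m -> 'I_n.+1} | (\sum_(k < m) j k <= n)%N)
     F (simplex_cons j).
Proof.
rewrite (reindex_onto (@simplex_cons m n) (fun J => [ffun k => J (lift ord0 k)])).
  apply: eq_bigl => j; rewrite (big_simplex_cons _ _ (fun _ x => x)).
  have -> : [ffun k => simplex_cons j (lift ord0 k)] = j.
    by apply/ffunP => k; rewrite ffunE simplex_cons_lift.
  rewrite eqxx andbT; apply/eqP/idP => [sj|].
    by apply: leq_trans (eq_leq sj); apply: leq_addl.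
  exact: subnK.
move=> J /eqP sJ; apply/ffunP => i; apply: val_inj => /=.
case: (unliftP ord0 i) => [k|] ->; first by rewrite simplex_cons_lift ffunE.
rewrite simplex_cons0; under eq_bigr => k _ do rewrite ffunE.
by apply: (canLR (addnK _)); rewrite -[LHS]sJ big_ord_recl.
Qed.

(** With s the sum of the tail, j_1 = n - s gives n + j_1 = 2n - s and mu_1^(j_1) = mu_1^n / mu_1^s;
    this denominator is spread over the remaining mu_k. *)
Lemma u_coef_ratio (K : fieldType) (m : nat) (mu : 'I_m.+1 -> K) (n : nat) :
  mu ord0 != 0 ->
  u_coef mu n =
    mu ord0 ^+ n / (n`! ^ m.+1)%N%:R *
    \sum_(j : {ffun 'I_m -> 'I_n.+1} | (\sum_(k < m) j k <= n)%N)
       ((2 * n - \sum_(k < m) j k)`! * \prod_(k < m) (n + j k)`!)%N%:R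
       / ((n - \sum_(k < m) j k)`! * \prod_(k < m) (j k)`!)%N%:R
       * \prod_(k < m) (mu (lift ord0 k) / mu ord0) ^+ j k.
Proof.
move=> mu0; rewrite [_ ^+ n / _]mulrC -mulrA; congr (_ * _).
rewrite sum_simplex_cons mulr_sumr; apply: eq_bigr => j le_jn.
rewrite (big_simplex_cons _ _ (fun _ x => (n + x)`!)).
rewrite (big_simplex_cons _ _ (fun _ x => x`!)).
rewrite (big_simplex_cons _ _ (fun i x => mu i ^+ x)).
rewrite addnBA // addnn -mul2n [RHS]mulrCA; congr (_ * _).
under [in RHS]eq_bigr => k _ do rewrite expr_div_n.
by rewrite prodf_div prodrXr expfB_cond ?(negPf mu0) // mulrAC mulrA.
Qed.

(* The number of parameters is m.+1, so that it is positive; mu ord0 is mu_1,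
   and mu (lift ord0 k), for k : 'I_m, runs through mu_2, ..., mu_(m.+1). *)
Theorem lemma2p21 (R : realType) (m : nat) (mu : 'I_m.+1 -> R[i]) :
  [/\ is_formal_inverse
        (fps_of_poly ('X * \prod_(i < m.+1) (1 - mu i *: 'X)))
        (fps_mul (fps_of_poly 'X)
           (fun n => if n == 0%N then 1 else (n.+1%:R)^-1 * u_coef mu n)),
      (2 <= m.+1)%N -> mu ord0 != 0 ->
        let y := fun k : 'I_m => mu (lift ord0 k) / mu ord0 in
        forall n : nat, (1 <= n)%N ->
        u_coef mu n =
          mu ord0 ^+ n / (n`! ^ m.+1)%N%:R *
          \sum_(j : {ffun 'I_m -> 'I_n.+1} | (\sum_(k < m) j k <= n)%N)
             ((2 * n - \sum_(k < m) j k)`! * \prod_(k < m) (n + j k)`!)%N%:R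
             / ((n - \sum_(k < m) j k)`! * \prod_(k < m) (j k)`!)%N%:R
             * \prod_(k < m) y k ^+ j k
    & m.+1 = 2%N -> mu ord0 != 0 ->
        let y := mu ord_max / mu ord0 in
        forall n : nat, (1 <= n)%N ->
        u_coef mu n =
          mu ord0 ^+ n / (n`! ^ 2)%N%:R *
          \sum_(0 <= k < n.+1)
             ((2 * n - k)`! * (n + k)`!)%N%:R / ((n - k)`! * k`!)%N%:R
             * y ^+ k].
Proof.
split.
- have -> : (fun n => if n == 0%N then 1 else n.+1%:R^-1 * u_coef mu n) =
    (fun n => (\prod_(i < m.+1) \poly_(j < n.+1) ('C(n + j, j)%:R * mu i ^+ j))`_n
              / n.+1%:R).
    (* At n = 0 the product has constant coefficient 1, which matches the separate case. *)
    apply/funext => n; rewrite u_coefE mulrC; case: n => //=.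
    rewrite divr1 -horner_coef0 horner_prod big1 // => i _.
    by rewrite horner_coef0 coef_poly bin0 mulr1.
  apply: lagrange_inversion.
    rewrite -horner_coef0 horner_prod big1 // => i _.
    by rewrite horner_coef0 coefB coefZ coefX mulr0 subr0 coef1.
  move=> l; rewrite -prodrXl -big_split /=.
  (* For exponent l + 1 the binomial is that of l + j over j, as in [u_coefE]. *)
  by apply: eq_mod_Xn_prod1 => i; apply: (@negative_binomial_poly _ _ _ l.+1).
- by move=> _ mu0 y n _; apply: u_coef_ratio.
- case: m mu => [|[|m]] // mu _ mu0 y n _; rewrite u_coef_ratio //.
  congr (_ * _).
  (* A family indexed by ['I_1] is a single index k. *)
  rewrite (reindex (fun k : 'I_n.+1 => [ffun _ : 'I_1 => k])) /=; last first.
    exists (fun j : {ffun 'I_1 -> 'I_n.+1} => j ord0) => [k|j] _; first by rewrite ffunE.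
    by apply/ffunP => k; rewrite ffunE !ord1.
  rewrite big_mkord; apply: eq_big => [k|k _]; rewrite !big_ord1 ffunE.
    by rewrite -ltnS ltn_ord.
  by have -> : lift ord0 ord0 = ord_max :> 'I_2 by apply: val_inj.
Qed.
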